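(* Let $G,H$ be finite, non-redundant, robustly rooted graphs and let $S_G$, $S_H$ be roots of $G$ and $H$ respectively. If the unfolding trees $\mathcal{T}(G,S_G)$ and $\mathcal{T}(H,S_H)$ are almost isomorphic, then $G$ and $H$ are isomorphic.
   Context: A graph is $G=(V,E,o,t)$ with vertex set $V$, edge set $E$, maps $o,t:E\to V$ (origin, terminus); loops and multiple edges allowed; finite means $V,E$ finite. Isomorphisms are pairs of bijections on vertices and edges compatible with $o,t$. $E_o(v)=\{e:o(e)=v\}$, $E_t(v)=\{e:t(e)=v\}$, $N_o(v)=t[E_o(v)]$. A walk is an empty walk $\epsilon_v$ ($O=T=v$) or $e_1\dots e_n$ with $t(e_i)=o(e_{i+1})$, $O=o(e_1)$, $T=t(e_n)$. A root is a vertex from which every vertex is reachable by a walk. For a vertex $x$, $G_x$ is the vertex-induced subgraph on the vertices reachable from $x$. A graph with a root is robustly rooted if for each vertex $v$ with $G_v=G$ there exists $w\in N_o(v)$ with $G_w=G$. An equivalence relation on $G$ is a pair of equivalence relations $\sim_V$, $\sim_E$ on $V$, $E$ with $e_1\sim_E e_2\Rightarrow o(e_1)\sim_V o(e_2), t(e_1)\sim_V t(e_2)$; it is non-edge-collapsing if for all $v\sim_V v'$ and every edge $e$ with $o(e)=v$ there is exactly one edge $e'$ with $o(e')=v'$ and $e\sim_E e'$; $G$ is non-redundant if its only non-edge-collapsing equivalence relation is the trivial one (both components equality). The unfolding tree $\mathcal{T}(G,S)$ has vertices the walks with origin $S$ and an edge from $w$ to $we$ whenever $e$ is an edge and $we$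 a walk. A tree is a graph in which any two vertices are termini of walks with a common origin, with no nonempty closed walks, and in which distinct edges have distinct termini. For a graph $G$ and subgraph $H$, $G\setminus H$ has edges $EG\setminus EH$ and vertices $VG$ minus those $v$ with $E_o(v),E_t(v)\neq\emptyset$ and $E_o(v)\cup E_t(v)\subseteq EH$. Trees $\mathcal{T}_1,\mathcal{T}_2$ are almost isomorphic if there exist finite subtrees $T_i\le\mathcal{T}_i$ and an isomorphism $\mathcal{T}_1\setminus T_1\to\mathcal{T}_2\setminus T_2$. *)

(* Defs.v *)
From mathcomp Require Import all_boot.
From mathcomp Require Import boolp classical_sets functions cardinality.
Set Implicit Arguments.
Unset Strict Implicit.
Unset Printing Implicit Defensive.

Local Open Scope classical_set_scope.

Record graph := Graph {
  vert : Type;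
  edge : Type;
  org : edge -> vert;
  ter : edge -> vert }.

Arguments org {g} _.
Arguments ter {g} _.

Definition finite_graph (G : graph) : Prop :=
  finite_set [set: vert G] /\ finite_set [set: edge G].

Definition isomorphic (G H : graph) : Prop :=
  exists (f : vert G -> vert H) (g : edge G -> edge H),
    [/\ bijective f, bijective g,
        forall e, org (g e) = f (org e)
      & forall e, ter (g e) = f (ter e)].

Section Walks.
Variable G : graph.

Definition edges_from (v : vert G) : set (edge G) := [set e | org e = v].
Definition edges_to (v : vert G) : set (edge G) := [set e | ter e = v].
Definition out_nbrs (v : vert G) : set (vert G) := ter @` edges_from v.

(* A walk is represented by its origin together with its sequence of edges, so
   that the empty walk at [v] is the pair of [v] and [[::]]; [walks_from v] is
   the set of edge sequences of the walks with origin [v]. *)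
Fixpoint is_walk (v : vert G) (p : seq (edge G)) : Prop :=
  if p is e :: q then org e = v /\ is_walk (ter e) q else True.

Definition walks_from (v : vert G) : set (seq (edge G)) := [set p | is_walk v p].

Definition terminus (v : vert G) (p : seq (edge G)) : vert G :=
  last v (map ter p).

Definition reachable (x y : vert G) : Prop :=
  exists2 p, walks_from x p & terminus x p = y.

Definition is_root (r : vert G) : Prop := forall v, reachable r v.

End Walks.

Record subgraph (G : graph) := Subgraph {
  sub_vert : set (vert G);
  sub_edge : set (edge G);
  sub_org : forall e, sub_edge e -> sub_vert (org e);
  sub_ter : forall e, sub_edge e -> sub_vert (ter e) }.

Definition graph_of_subgraph (G : graph) (H : subgraph G) : graph :=
  {| vert := set_type (sub_vert H);
     edge := set_type (sub_edge H);
     org := fun e => exist _ (org (val e)) (mem_set (sub_org (set_mem (valP e))));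
     ter := fun e => exist _ (ter (val e)) (mem_set (sub_ter (set_mem (valP e)))) |}.

Coercion graph_of_subgraph : subgraph >-> graph.

Lemma subgraph_eqP (G : graph) (H K : subgraph G) :
  H = K <-> sub_vert H = sub_vert K /\ sub_edge H = sub_edge K.
Proof.
split=> [-> //|]; case: H K => [A B o t] [A' B' o' t'] /= [eA eB].
case: A' / eA o' t' => o' t'; case: B' / eB o' t' => o' t'.
by congr Subgraph; exact: Prop_irrelevance.
Qed.

Definition full_subgraph (G : graph) : subgraph G :=
  @Subgraph G setT setT (fun _ _ => I) (fun _ _ => I).

Definition induced_subgraph (G : graph) (A : set (vert G)) : subgraph G :=
  @Subgraph G A [set e | A (org e) /\ A (ter e)]
    (fun _ h => proj1 h) (fun _ h => proj2 h).

Definition reach_subgraph (G : graph) (x : vert G) : subgraph G :=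
  induced_subgraph (reachable x).

Definition robustly_rooted (G : graph) : Prop :=
  (exists r : vert G, is_root r) /\
  forall v : vert G, reach_subgraph v = full_subgraph G ->
    exists2 w, out_nbrs v w & reach_subgraph w = full_subgraph G.

Record graph_equiv (G : graph) := GraphEquiv {
  veq : vert G -> vert G -> Prop;
  eeq : edge G -> edge G -> Prop;
  veq_equiv : RelationClasses.Equivalence veq;
  eeq_equiv : RelationClasses.Equivalence eeq;
  eeq_org : forall e1 e2, eeq e1 e2 -> veq (org e1) (org e2);
  eeq_ter : forall e1 e2, eeq e1 e2 -> veq (ter e1) (ter e2) }.

Definition non_edge_collapsing (G : graph) (R : graph_equiv G) : Prop :=
  forall v v', veq R v v' -> forall e, org e = v ->
    exists! e', org e' = v' /\ eeq R e e'.

Definition trivial_equiv (G : graph) (R : graph_equiv G) : Prop :=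
  (forall v v', veq R v v' <-> v = v') /\ (forall e e', eeq R e e' <-> e = e').

Definition non_redundant (G : graph) : Prop :=
  forall R : graph_equiv G, non_edge_collapsing R -> trivial_equiv R.

Section Unfolding.
Variables (G : graph) (S : vert G).

Definition extensions : set (seq (edge G) * edge G) :=
  [set we | walks_from S (rcons we.1 we.2)].

Lemma extensions_src we : extensions we -> walks_from S we.1.
Proof.
case: we => w e; rewrite /extensions /walks_from /=.
by elim: w S => //= a w IHw v [-> /IHw].
Qed.

Definition unfolding_tree : graph :=
  {| vert := set_type (walks_from S);
     edge := set_type extensions;
     org := fun we => exist _ (val we).1
              (mem_set (extensions_src (set_mem (valP we))));
     ter := fun we => exist _ (rcons (val we).1 (val we).2)
              (mem_set (set_mem (valP we) : walks_from S _)) |}.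

End Unfolding.

Definition is_tree (T : graph) : Prop :=
  [/\ forall u v : vert T, exists x, reachable x u /\ reachable x v,
      forall (v : vert T) p, walks_from v p -> terminus v p = v -> p = [::]
    & forall e e' : edge T, e <> e' -> ter e <> ter e'].

Section Difference.
Variables (G : graph) (H : subgraph G).

(* Incidence is taken in the ambient graph [G]; a vertex without incoming edges
   or without outgoing edges (a root or a leaf of a tree) is never discarded. *)
Definition swallowed : set (vert G) :=
  [set v | [/\ edges_from v !=set0, edges_to v !=set0
             & edges_from v `|` edges_to v `<=` sub_edge H]].

Lemma diff_org e : (~` sub_edge H) e -> (~` swallowed) (org e).
Proof. by move=> He [_ _ sub]; apply: He; apply: sub; left. Qed.

Lemma diff_ter e : (~` sub_edge H) e -> (~` swallowed) (ter e).
Proof. by move=> He [_ _ sub]; apply: He; apply: sub; right. Qed.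

Definition diff_subgraph : subgraph G := Subgraph diff_org diff_ter.

End Difference.

Definition almost_isomorphic (T1 T2 : graph) : Prop :=
  exists (A1 : subgraph T1) (A2 : subgraph T2),
    [/\ finite_graph A1 /\ is_tree A1, finite_graph A2 /\ is_tree A2
      & isomorphic (diff_subgraph A1) (diff_subgraph A2)].

(* Main.v *)
Require Import Defs.
From mathcomp Require Import all_boot.
From mathcomp Require Import boolp classical_sets functions cardinality.

Set Implicit Arguments.
Unset Strict Implicit.
Unset Printing Implicit Defensive.

Local Open Scope classical_set_scope.

(** Call vertices [v] and [w] similar when they are related by a relation [R]
    such that the edges out of [R]-related vertices can be matched bijectively
    with [R]-related termini; this is isomorphism of the unfolding trees at [v]
    and [w]. In a non-redundant graph similar vertices are equal, so similarity
    between [G] and [H] is a partial bijection, and it induces an isomorphism as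
    soon as it is total on both sides. By robust rootedness some walk from [SG]
    stays on roots of [G] for ever; along it both the tree vertex and its image
    under the almost isomorphism eventually leave the finite subtrees, below
    which the almost isomorphism matches edges bijectively. So some root of [G]
    is similar to a vertex of [H], hence every vertex of [G] is, and symmetrically. *)

(** * Similarity as the largest bisimulation *)

Section Similarity.
Variables G H : graph.

(* Matchings are relations rather than functions because [edge H] may be empty. *)
Record matching (R : vert G -> vert H -> Prop) (v : vert G) (w : vert H)
    (M : edge G -> edge H -> Prop) : Prop := Matching {
  match_org : forall e e', M e e' -> org e = v /\ org e' = w;
  match_ter : forall e e', M e e' -> R (ter e) (ter e');
  match_total : forall e, org e = v -> exists e', M e e';
  match_surj : forall e', org e' = w -> exists e, M e e';
  match_fun : forall e e1 e2, M e e1 -> M e e2 -> e1 = e2;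
  match_inj : forall e1 e2 e', M e1 e' -> M e2 e' -> e1 = e2 }.

Definition bisimulation (R : vert G -> vert H -> Prop) : Prop :=
  forall v w, R v w -> exists M, matching R v w M.

Definition similar (v : vert G) (w : vert H) : Prop :=
  exists2 R, bisimulation R & R v w.

(** A matching whose termini are related by some bisimulation also has similar termini, so the union
    of all bisimulations is one itself. *)
Lemma similar_bisimulation : bisimulation similar.
Proof.
move=> v w [R bR Rvw]; have [M [Mo Mt Ml Mr Mf Mi]] := bR _ _ Rvw.
exists M; split=> // e e' Mee'; exists R => //; exact: Mt.
Qed.

(** Each edge of the walk is carried across by a matching, which keeps the termini similar. *)
Lemma similar_reachable v w v' :
  similar v w -> reachable v v' -> exists w', similar v' w'.
Proof.
move=> + [p + <-]; elim: p v w => [|e p IHp] v w vw /=; first by exists w.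
move=> [ev wp]; have [M mM] := similar_bisimulation vw.
have [e' Mee'] := match_total mM ev.
exact: IHp (match_ter mM Mee') wp.
Qed.

End Similarity.

Lemma similar_refl (G : graph) (v : vert G) : similar v v.
Proof.
exists eq => // u _ <-; exists (fun e e' => org e = u /\ e = e').
split=> [e _ [<- <-]|e _ [_ <-]|e <-|e <-|e e1 e2 [_ <-] [_ <-]|
         e1 e2 e [_ ->] [_ ->]] //; by exists e.
Qed.

Lemma similar_sym (G H : graph) (v : vert G) (w : vert H) :
  similar v w -> similar w v.
Proof.
case=> R bR Rvw; exists (fun x y => R y x) => // x y /bR[M [Mo Mt Ml Mr Mf Mi]].
exists (fun e e' => M e' e); split=> //.
- by move=> e e' /Mo[].
- by move=> e e' /Mt.
- by move=> e e1 e2; exact: Mi.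
- by move=> e1 e2 e; exact: Mf.
Qed.

Lemma similar_trans (G H K : graph) (u : vert G) (v : vert H) (w : vert K) :
  similar u v -> similar v w -> similar u w.
Proof.
move=> uv vw; exists (fun x z => exists2 y : vert H, similar x y & similar y z);
  last by exists v.
move=> x z [y /similar_bisimulation[M mM] /similar_bisimulation[N mN]].
exists (fun e g => exists2 f, M e f & N f g); split.
- by move=> e g [f /(match_org mM)[-> _] /(match_org mN)[_ ->]].
- move=> e g [f Mef Nfg]; exists (ter f); first exact: (match_ter mM Mef).
  exact: (match_ter mN Nfg).
- move=> e /(match_total mM)[f Mef].
  by have [g Nfg] := match_total mN (proj2 (match_org mM Mef)); exists g, f.
- move=> g /(match_surj mN)[f Nfg].
  by have [e Mef] := match_surj mM (proj1 (match_org mN Nfg)); exists e, f.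
- move=> e g1 g2 [f1 M1 N1] [f2 M2 N2].
  rewrite -(match_fun mM M1 M2) in N2; exact: (match_fun mN N1 N2).
- move=> e1 e2 g [f1 M1 N1] [f2 M2 N2].
  rewrite -(match_inj mN N1 N2) in M2; exact: (match_inj mM M1 M2).
Qed.

(** This makes the representative chosen from a similarity class depend on the class alone, not on
    the vertex that presents it. *)
Lemma cid_eq (T : Type) (P Q : set T) (p : exists x, P x) (q : exists x, Q x) :
  P = Q -> sval (cid p) = sval (cid q).
Proof. by move=> PQ; case: Q / PQ q => q; rewrite (Prop_irrelevance p q). Qed.

(* Edges are identified through matchings with the edges out of a chosen
   representative of each similarity class, so that the matchings are coherent. *)
Lemma non_redundant_similar (G : graph) (u v : vert G) :
  non_redundant G -> similar u v -> u = v.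
Proof.
move=> nrG.
pose rep (x : vert G) := sval (cid (ex_intro (similar x) x (similar_refl x))).
have repP x : similar x (rep x) by rewrite /rep; case: cid.
have rep_eq x y : similar x y -> rep x = rep y.
  move=> xy; apply/cid_eq/funext => z; apply/propext; split.
    exact: similar_trans (similar_sym xy).
  exact: similar_trans xy.
have [M mM] := choice (fun x => similar_bisimulation (repP x)).
pose E (e e' : edge G) := similar (org e) (org e') /\
  exists2 k, M (org e) e k & M (org e') e' k.
have equivV : RelationClasses.Equivalence (@similar G G).
  split=> [x|x y|x y z]; [exact: similar_refl|exact: similar_sym|].
  exact: similar_trans.
have equivE : RelationClasses.Equivalence E.
  split=> [e|e e' [oee' [k Mk Mk']]|e1 e2 e3 [o12 [k M1 M2]] [o23 [k' M2' M3]]].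
  - split; first exact: similar_refl.
    by have [k Mk] := match_total (mM (org e)) erefl; exists k.
  - by split; [exact: similar_sym|exists k].
  - split; first exact: similar_trans o12 o23.
    by exists k => //; rewrite (match_fun (mM _) M2 M2').
have E_org e1 e2 : E e1 e2 -> similar (org e1) (org e2) by case.
have E_ter e1 e2 : E e1 e2 -> similar (ter e1) (ter e2).
  move=> [_ [k M1 M2]]; apply: similar_trans (match_ter (mM _) M1) _.
  exact/similar_sym/(match_ter (mM _) M2).
have [|trivV _] := nrG (GraphEquiv equivV equivE E_org E_ter); last first.
  by move=> uv; apply/trivV.
(* Since [x] and [x'] share a representative, the edge [k] matched with [e] is also matched with
   exactly one edge out of [x']. *)
move=> x x' /= xx' e ex.
have [k Mk] := match_total (mM x) ex.
have ok : org k = rep x' by rewrite -(rep_eq _ _ xx'); exact: (match_org (mM x) Mk).2.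
have [e' Mk'] := match_surj (mM x') ok; have [ex' _] := match_org (mM x') Mk'.
exists e'; split.
  by split=> //; split; rewrite ex ex' //; exists k.
move=> e2 [e2x' [_ [k2]]]; rewrite ex e2x' => Mk2 Mk2'.
rewrite (match_fun (mM _) Mk2 Mk) in Mk2'.
exact: (match_inj (mM x') Mk' Mk2').
Qed.

(** By non-redundancy, similar partners are unique, so choices in the two directions are mutually
    inverse; the edge maps are read off the matchings between [v] and [f v]. *)
Lemma isomorphic_of_similar (G H : graph) :
  non_redundant G -> non_redundant H ->
  (forall v : vert G, exists w : vert H, similar v w) ->
  (forall w : vert H, exists v : vert G, similar v w) ->
  isomorphic G H.
Proof.
move=> nrG nrH /choice[f fP] /choice[f' f'P].
have ff' : cancel f' f.
  move=> w; apply: (non_redundant_similar nrH).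
  exact: similar_trans (similar_sym (fP _)) (f'P w).
have f'f : cancel f f'.
  move=> v; apply: (non_redundant_similar nrG).
  exact: similar_trans (f'P _) (similar_sym (fP v)).
have [M mM] := choice (fun v => similar_bisimulation (fP v)).
have /choice[g gP] e : exists e', M (org e) e e' by exact: (match_total (mM _) _).
have /choice[g' g'P] e' : exists e, M (f' (org e')) e e'.
  by apply: (match_surj (mM _)); rewrite ff'.
have g_org e : org (g e) = f (org e) := (match_org (mM _) (gP e)).2.
exists f, g; split=> //.
- by exists f'.
- exists g' => [e|e'].
    have := g'P (g e); rewrite g_org f'f => Mge.
    exact: (match_inj (mM _) Mge (gP e)).
  have := gP (g' e'); rewrite (match_org (mM _) (g'P e')).1 => Mge.
  exact: (match_fun (mM _) Mge (g'P e')).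
(* Both [ter (g e)] and [f (ter e)] are similar to [ter e]. *)
- move=> e; apply: (non_redundant_similar nrH).
  exact: similar_trans (similar_sym (match_ter (mM _) (gP e))) (fP _).
Qed.

Lemma isomorphic_sym (G H : graph) : isomorphic G H -> isomorphic H G.
Proof.
move=> [f [g [[f' f'f ff'] [g' g'g gg'] fo ft]]]; exists f', g'; split.
- by exists f.
- by exists g.
- by move=> e; rewrite -{2}(gg' e) fo f'f.
- by move=> e; rewrite -{2}(gg' e) ft f'f.
Qed.

Lemma almost_isomorphic_sym (T1 T2 : graph) :
  almost_isomorphic T1 T2 -> almost_isomorphic T2 T1.
Proof. by move=> [A1 [A2 [? ? /isomorphic_sym ?]]]; exists A2, A1. Qed.

(** * Roots and extension of walks *)

Lemma reach_subgraph_full (G : graph) (v : vert G) :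
  reach_subgraph v = full_subgraph G <-> is_root v.
Proof.
split=> [/subgraph_eqP[/= vT _] w|rv].
  by have : [set: vert G] w by []; rewrite -vT.
by apply/subgraph_eqP; split; apply/seteqP; split=> // x _; exact: rv.
Qed.

Lemma terminus_rcons (G : graph) (v : vert G) p e :
  terminus v (rcons p e) = ter e.
Proof. by rewrite /terminus map_rcons last_rcons. Qed.

Lemma walks_from_rcons (G : graph) (v : vert G) p e :
  walks_from v (rcons p e) <-> walks_from v p /\ org e = terminus v p.
Proof.
rewrite /walks_from/= /terminus; elim: p v => [|a p IHp] v /=.
  by split=> [[->]|[_ ->]].
by rewrite (propext (IHp _)); split=> [[-> []]|[[-> ?] ?]].
Qed.

(** * Unfolding trees with a finite subtree removed *)

Section TreeMinusFinite.
Variables (G : graph) (S : vert G) (A : subgraph (unfolding_tree S)).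
Local Notation T := (unfolding_tree S).
Local Notation D := (diff_subgraph A).

Definition walk_of (Y : vert D) : seq (edge G) := val (val Y).
(** Together with [label], this is the graph morphism projecting the remaining part of the tree to
    [G]. *)
Definition end_of (Y : vert D) : vert G := terminus S (walk_of Y).
Definition label (E : edge D) : edge G := (val (val E)).2.

Lemma walk_of_ter (E : edge D) : walk_of (ter E) = rcons (walk_of (org E)) (label E).
Proof. by []. Qed.

Lemma end_of_ter (E : edge D) : end_of (ter E) = ter (label E).
Proof. by rewrite /end_of walk_of_ter terminus_rcons. Qed.

Lemma org_label (E : edge D) : org (label E) = end_of (org E).
Proof.
have /walks_from_rcons[_ ->] : walks_from S (rcons (walk_of (org E)) (label E)).
  exact: set_mem (valP (val E)).
by [].
Qed.

Lemma label_inj (E1 E2 : edge D) : org E1 = org E2 -> label E1 = label E2 -> E1 = E2.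
Proof.
move=> o12 l12; apply/val_inj/val_inj; apply: injective_projections => //.
exact: (congr1 walk_of o12).
Qed.

Variable n : nat.
Hypothesis sub_edge_size : forall E : edge T, sub_edge A E -> size (val E).1 < n.

(** Edges starting at depth [n] or more lie outside [A], so all edges out of a deep vertex
    survive. *)
Lemma edge_of_label (Y : vert D) (e : edge G) :
  n <= size (walk_of Y) -> org e = end_of Y -> exists2 E, org E = Y & label E = e.
Proof.
move=> nY oe.
have ext : extensions S (walk_of Y, e).
  by apply/walks_from_rcons; split=> //; exact: set_mem (valP (val Y)).
pose E : edge T := exist _ (walk_of Y, e) (mem_set ext).
have EA : (~` sub_edge A) E by move=> /sub_edge_size /=; rewrite ltnNge nY.
by exists (exist _ E (mem_set EA)) => //; apply/val_inj/val_inj.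
Qed.

(** The bound is strict because the vertex is obtained as terminus of its last edge, whose origin
    must already have depth at least [n]. *)
Lemma vert_of_walk (p : seq (edge G)) :
  n < size p -> walks_from S p -> exists Y, walk_of Y = p.
Proof.
case/lastP: p => // p e; rewrite size_rcons ltnS => np wpe.
pose E : edge T := exist _ (p, e) (mem_set (wpe : extensions S (p, e))).
have EA : (~` sub_edge A) E by move=> /sub_edge_size /=; rewrite ltnNge np.
by exists (ter (exist _ E (mem_set EA) : edge D)).
Qed.

End TreeMinusFinite.

Lemma finite_subgraph_size (G : graph) (S : vert G)
    (A : subgraph (unfolding_tree S)) : finite_graph A ->
  exists n, forall E : edge (unfolding_tree S), sub_edge A E -> size (val E).1 < n.
Proof.
case=> _ /(finite_image (fun E : edge A => size (val (val E)).1)).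
move=> /finite_seqP[s sE]; exists (\max_(i <- s) i).+1 => E AE.
have Es : [set` s] (size (val E).1).
  by rewrite -sE; exists (exist _ E (mem_set AE)).
by rewrite ltnS; exact: leq_bigmax_seq.
Qed.

(** * Transfer of similarity through an almost isomorphism *)

Section AlmostIsomorphism.
Variables (G H : graph) (SG : vert G) (SH : vert H).
Variables (A : subgraph (unfolding_tree SG)) (B : subgraph (unfolding_tree SH)).
Local Notation D := (diff_subgraph A).
Local Notation D' := (diff_subgraph B).
Variables (nA nB : nat).
Hypothesis sizeA : forall E : edge (unfolding_tree SG), sub_edge A E -> size (val E).1 < nA.
Hypothesis sizeB : forall E : edge (unfolding_tree SH), sub_edge B E -> size (val E).1 < nB.
Variables (f : vert D -> vert D') (g : edge D -> edge D').
Hypotheses (bij_f : bijective f) (bij_g : bijective g).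
Hypothesis f_org : forall e, org (g e) = f (org e).
Hypothesis f_ter : forall e, ter (g e) = f (ter e).

(** The pairs of ends of [Z] and [f Z], with both deep, form a bisimulation: passing to a child
    increases both depths by one. *)
Lemma similar_ends (Y : vert D) :
  nA <= size (walk_of Y) -> nB <= size (walk_of (f Y)) ->
  similar (end_of Y) (end_of (f Y)).
Proof.
move=> YA YB; exists (fun v w => exists2 Z, nA <= size (walk_of Z) /\
  nB <= size (walk_of (f Z)) & end_of Z = v /\ end_of (f Z) = w); last by exists Y.
move=> _ _ {Y YA YB} [Y [YA YB] [<- <-]].
exists (fun e e' => exists2 E, org E = Y & label E = e /\ label (g E) = e'); split.
- by move=> _ _ [E <- [<- <-]]; rewrite !org_label f_org.
- move=> _ _ [E EY [<- <-]]; exists (ter E); last by rewrite -f_ter !end_of_ter.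
  by rewrite -f_ter !walk_of_ter f_org EY !size_rcons !leqW.
- move=> e /(edge_of_label sizeA YA)[E EY Ee].
  by exists (label (g E)), E.
- move=> e' /(edge_of_label sizeB YB)[E' EY Ee].
  (* The edge at [f Y] is pulled back along [g]; injectivity of [f] makes its preimage start at
     [Y]. *)
  have [g' _ gg'] := bij_g.
  exists (label (g' E')), (g' E'); rewrite ?gg' //.
  by apply: (bij_inj bij_f); rewrite -f_org gg'.
- move=> e e1 e2 [E1 o1 [l1 <-]] [E2 o2 [l2 <-]].
  by rewrite (@label_inj _ _ _ E1 E2) ?o1 ?o2 ?l1 ?l2.
- move=> e1 e2 e' [E1 o1 [<- l1]] [E2 o2 [<- l2]].
  congr label; apply: (bij_inj bij_g); apply: label_inj; last by rewrite l1.
  by rewrite !f_org o1 o2.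
Qed.

Lemma root_walk (m : nat) : robustly_rooted G -> is_root SG ->
  exists p, [/\ walks_from SG p, size p = m & is_root (terminus SG p)].
Proof.
move=> [_ rrG] rootG; elim: m => [|m [p [wp sp rp]]]; first by exists [::].
have /reach_subgraph_full/rrG[_ [e oe <-] /reach_subgraph_full re] := rp.
exists (rcons p e); rewrite size_rcons sp terminus_rcons; split=> //.
exact/walks_from_rcons.
Qed.

(** [f] need not respect depth, so the descent continues through roots below a deep [Y]; each edge
    also lengthens the walk of the image by one. *)
Lemma deep_root (j : nat) : robustly_rooted G -> is_root SG ->
  exists Y : vert D, [/\ nA <= size (walk_of Y), j <= size (walk_of (f Y))
                       & is_root (end_of Y)].
Proof.
move=> rrG rootG; elim: j => [|j [Y [YA Yj rY]]].
  have [p [wp sp rp]] := root_walk nA.+1 rrG rootG.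
  have [|Y Yp] := vert_of_walk sizeA _ wp; first by rewrite sp.
  by exists Y; rewrite /end_of Yp sp.
have /reach_subgraph_full/(proj2 rrG)[_ [e oe <-] /reach_subgraph_full re] := rY.
have [E EY Ee] := edge_of_label sizeA YA oe.
exists (ter E); rewrite -f_ter end_of_ter !walk_of_ter !size_rcons f_org EY Ee.
by rewrite leqW.
Qed.

End AlmostIsomorphism.

Lemma almost_isomorphic_similar (G H : graph) (SG : vert G) (SH : vert H) :
  robustly_rooted G -> is_root SG ->
  almost_isomorphic (unfolding_tree SG) (unfolding_tree SH) ->
  forall v : vert G, exists w : vert H, similar v w.
Proof.
move=> rrG rootG [A [B [[finA _] [finB _] [f [g [bf bg fo ft]]]]]] v.
have [nA sizeA] := finite_subgraph_size finA.
have [nB sizeB] := finite_subgraph_size finB.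
have [Y [YA YB rY]] := deep_root sizeA fo ft nB rrG rootG.
exact: similar_reachable (similar_ends sizeA sizeB bf bg fo ft YA YB) (rY v).
Qed.

Theorem theorem7 (G H : graph)
    (finG : finite_graph G) (finH : finite_graph H)
    (nrG : non_redundant G) (nrH : non_redundant H)
    (rrG : robustly_rooted G) (rrH : robustly_rooted H)
    (SG : vert G) (SH : vert H) (rootG : is_root SG) (rootH : is_root SH)
    (aiso : almost_isomorphic (unfolding_tree SG) (unfolding_tree SH)) :
  isomorphic G H.
Proof.
apply: isomorphic_of_similar => //.
  exact: almost_isomorphic_similar rrG rootG aiso.
(* The other direction is the same lemma with [G] and [H] exchanged. *)
move=> w.
have [v /similar_sym vw] :=
  almost_isomorphic_similar rrH rootH (almost_isomorphic_sym aiso) w.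
by exists v.
Qed.
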